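(* Let $G$ be a group and let $\Bbbk$ be a field. The following statements hold. (1) The finite Kleisli convolution representations of $G$ (with respect to the powerset monad) and their homomorphisms form a category $\mathsf{Klcrep}(G)$, and there is an equivalence of categories $$\mathsf{Klcrep}(G)\simeq \mathsf{Perm}(G),$$ where $\mathsf{Perm}(G)$ is the category of finite permutation representations of $G$. (2) The linear Kleisli convolution representations of $G$ over $\Bbbk$ and their homomorphisms form a category $\mathsf{Klcrep}_{\Bbbk}(G)$, and there is a $\Bbbk$-linear equivalence of categories $$\mathsf{Klcrep}_{\Bbbk}(G)\simeq \mathsf{rep}_{\Bbbk}(G),$$ where $\mathsf{rep}_{\Bbbk}(G)$ is the category of finite-dimensional linear representations of $G$ over $\Bbbk$.
   Context: Throughout, $\mathbf 1=\{\bullet\}$ is a singleton set, and for a finite set $X$ put $E_X=X\times X$. **Powerset monad.** $\mathscr P=(\mathcal P,\eta,\mu)$ is the monad on $\mathsf{Set}$ with $\mathcal P(X)$ the set of all subsets of $X$, $\mathcal P(f)$ the direct image map, $\eta_X(x)=\{x\}$, $\mu_X(\mathcal A)=\bigcup_{A\in\mathcal A}A$. A Kleisli arrow $X\rightsquigarrow Y$ is a map $X\to\mathcal P(Y)$. The object $E_X$ is a monoid object of the Kleisli category (tensor product of objects is the Cartesian product) with multiplication $m_X((i,j),(p,q))=\{(i,q)\}$ if $j=p$ and $\emptyset$ otherwise, and unit $u_X(\bullet)=\{(x,x):x\in X\}$. Let $\mathbb H_{\mathscr P}(X)=\mathrm{Hom}_{\mathsf{Kl}(\mathscr P)}(\mathbf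 1,E_X)$, the set of maps $\mathbf 1\to\mathcal P(X\times X)$. The Kleisli convolution $f\ast g$ is the Kleisli composite of $\mathbf 1\cong\mathbf 1\times\mathbf 1$, the Kleisli tensor product $f\otimes g$ and $m_X$; explicitly $$(f\ast g)(\bullet)=\{(i,q): (i,j)\in f(\bullet)\text{ and }(j,q)\in g(\bullet)\text{ for some }j\in X\}.$$ With it $\mathbb H_{\mathscr P}(X)$ is a monoid with unit $u_X$, and its invertible elements are exactly the $f$ with $f(\bullet)=\{(\sigma(x),x):x\in X\}$ for a (unique) permutation $\sigma$ of $X$. **Finite Kleisli convolution representations.** Such a representation of $G$ is a pair $(X,\rho)$ with $X$ a finite set and $\rho:G\to\mathbb H_{\mathscr P}(X)$ a monoid homomorphism. For $g\in G$ let $\sigma_{X,g}$ be the unique permutation of $X$ with $\rho(g)(\bullet)=\{(\sigma_{X,g}(x),x):x\in X\}$. A homomorphism $(X,\rho_X)\to(Y,\rho_Y)$ is a map $f:X\to Y$ with $f(\sigma_{X,g}(x))=\sigma_{Y,g}(f(x))$ for all $g\in G$, $x\in X$; composition is composition of maps. $\mathsf{Perm}(G)$ has as objects pairs $(X,\sigma_X)$ with $X$ a finite set and $\sigma_X:G\to\mathrm{Sym}(X)$ a group homomorphism (finite left $G$-sets), and as morphisms the $G$-equivariant maps. **Free $\Bbbk$-module monad.** For a set $X$, $\mathcal M_{\Bbbk}(X)$ is the set of finite formal sums $\sum_{x\in X}a_x[x]$, $a_x\in\Bbbk$. With $\mathcal M_{\Bbbk}(f)(\sum a_x[x])=\sum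 a_x[f(x)]$, unit $x\mapsto[x]$ and multiplication $\sum_\ell c_\ell[\sum_x a_{\ell,x}[x]]\mapsto\sum_x(\sum_\ell c_\ell a_{\ell,x})[x]$ this is a monad $\mathscr M_{\Bbbk}$ on $\mathsf{Set}$. A Kleisli arrow $f:X\rightsquigarrow Y$ is a map $f:X\to\mathcal M_{\Bbbk}(Y)$, $f(x)=\sum_y f_{y,x}[y]$; its matrix is $[f]=(f_{y,x})$, Kleisli composition satisfies $[h\circ_{\mathsf{Kl}}f]=[h][f]$, and the Kleisli identity $x\mapsto[x]$ has identity matrix. For finite $X$, $\mathbb H_{\Bbbk}(X)=\mathrm{Hom}_{\mathsf{Kl}(\mathscr M_{\Bbbk})}(\mathbf 1,E_X)$ is a unital $\Bbbk$-algebra with pointwise linear structure and multiplication the Kleisli convolution (Kleisli composite of $\mathbf 1\cong\mathbf 1\times\mathbf 1$, $f\otimes g$, and $m_X$, where $m_X((i,j),(p,q))=[(i,q)]$ if $j=p$ and $0$ otherwise), with unit $u_X(\bullet)=\sum_{x\in X}[(x,x)]$. The map $\Phi_X:\mathbb H_{\Bbbk}(X)\to\mathrm{Mat}_X(\Bbbk)$, $\Phi_X(f)=(f_{i,j})_{i,j\in X}$ where $f(\bullet)=\sum f_{i,j}[(i,j)]$, is an isomorphism of $\Bbbk$-algebras onto the algebra of $X\times X$ matrices with ordinary multiplication. **Linear Kleisli convolution representations.** Such a representation of $G$ is a pair $(X,\rho)$ with $X$ a finite set and $\rho:\Bbbk G\to\mathbb H_{\Bbbk}(X)$ a unital $\Bbbk$-algebra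 homomorphism from the group algebra. A homomorphism $(X,\rho_X)\to(Y,\rho_Y)$ is a Kleisli arrow $f:X\rightsquigarrow Y$ in $\mathsf{Kl}(\mathscr M_{\Bbbk})$ such that $\Phi_Y(\rho_Y(a))[f]=[f]\Phi_X(\rho_X(a))$ for all $a\in\Bbbk G$; composition is Kleisli composition. Morphisms are added and scaled via their matrices. $\mathsf{rep}_{\Bbbk}(G)$ is the category of finite-dimensional $\Bbbk$-vector spaces $V$ with a group homomorphism $G\to\mathrm{GL}(V)$ (equivalently finite-dimensional left $\Bbbk G$-modules), with $\Bbbk G$-linear maps. *)

(* Defs.v *)
From HB Require Import structures.
From mathcomp Require Import all_boot all_order all_algebra.
From mathcomp Require Import fingroup perm.
From mathcomp Require Import finmap.
From mathcomp Require Import mathcomp_extra boolp classical_sets functions.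
From mathcomp.multinomials Require Import monalg.

Set Implicit Arguments.
Unset Strict Implicit.
Unset Printing Implicit Defensive.

Import GRing.Theory.
Local Open Scope classical_set_scope.
Local Open Scope ring_scope.

(* The laws are kept apart from the operations, so that being a category is
   a proposition that can be asserted of given objects and arrows. *)
Record precategory := Precategory {
  obj :> Type;
  hom : obj -> obj -> Type;
  idm : forall x, hom x x;
  comp : forall x y z, hom y z -> hom x y -> hom x z }.

Arguments idm {p} x.
Arguments comp {p x y z} h f.

Definition is_category (C : precategory) : Prop :=
  [/\ forall (x y : C) (f : hom x y), comp (idm y) f = f,
      forall (x y : C) (f : hom x y), comp f (idm x) = f &
      forall (w x y z : C) (h : hom y z) (g : hom x y) (f : hom w x),
        comp h (comp g f) = comp (comp h g) f].

Record functor (C D : precategory) := Functor {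
  fobj :> C -> D;
  fmor : forall x y, hom x y -> hom (fobj x) (fobj y);
  fmor_id : forall x, fmor (idm x) = idm (fobj x);
  fmor_comp : forall x y z (h : hom y z) (f : hom x y),
    fmor (comp h f) = comp (fmor h) (fmor f) }.

Arguments fmor {C D} f {x y} _ : rename.

Section FunctorOps.
Variables C D E : precategory.

Definition functor_id : functor C C :=
  @Functor C C id (fun _ _ => id) (fun _ => erefl) (fun _ _ _ _ _ => erefl).

Variables (G : functor D E) (F : functor C D).

Lemma functor_comp_id x : fmor G (fmor F (idm x)) = idm (G (F x)).
Proof. by rewrite !fmor_id. Qed.

Lemma functor_comp_comp x y z (h : hom y z) (f : hom x y) :
  fmor G (fmor F (comp h f)) = comp (fmor G (fmor F h)) (fmor G (fmor F f)).
Proof. by rewrite !fmor_comp. Qed.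

Definition functor_comp : functor C E :=
  @Functor C E (fun x => G (F x)) (fun x y f => fmor G (fmor F f))
    functor_comp_id functor_comp_comp.
End FunctorOps.

Definition is_iso (C : precategory) (x y : C) (f : hom x y) : Prop :=
  exists g : hom y x, comp g f = idm x /\ comp f g = idm y.

Definition naturally_isomorphic (C D : precategory) (F G : functor C D) : Prop :=
  exists eta : forall x, hom (F x) (G x),
    (forall x, is_iso (eta x)) /\
    (forall (x y : C) (f : hom x y),
       comp (eta y) (fmor F f) = comp (fmor G f) (eta x)).

Definition quasi_inverse (C D : precategory) (F : functor C D)
    (G : functor D C) : Prop :=
  naturally_isomorphic (functor_comp G F) (functor_id C) /\
  naturally_isomorphic (functor_comp F G) (functor_id D).

Definition equivalent (C D : precategory) : Prop :=
  exists (F : functor C D) (G : functor D C), quasi_inverse F G.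

(* Morphism spaces are k-modules; bilinearity of the composition is part of
   is_linear_category. *)
Record lprecategory (k : fieldType) := LPrecategory {
  lobj : Type;
  lhom : lobj -> lobj -> lmodType k;
  lidm : forall x, lhom x x;
  lcomp : forall x y z, lhom y z -> lhom x y -> lhom x z }.

Definition precategory_of_l (k : fieldType) (C : lprecategory k) :=
  @Precategory (lobj C) (@lhom k C) (@lidm k C) (@lcomp k C).

Coercion precategory_of_l : lprecategory >-> precategory.

Definition is_linear_category (k : fieldType) (C : lprecategory k) : Prop :=
  [/\ is_category C,
      forall (x y z : lobj C) (f : lhom x y),
        linear (fun h : lhom y z => lcomp h f) &
      forall (x y z : lobj C) (h : lhom y z),
        linear (fun f : lhom x y => lcomp h f)].

Definition linear_functor (k : fieldType) (C D : lprecategory k)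
    (F : functor C D) : Prop :=
  forall x y : lobj C, linear (fmor F : lhom x y -> lhom (F x) (F y)).

Definition linearly_equivalent (k : fieldType) (C D : lprecategory k) : Prop :=
  exists (F : functor C D) (G : functor D C),
    [/\ linear_functor F, linear_functor G & quasi_inverse F G].

Record monad := Monad {
  mobj :> Type -> Type;
  mmap : forall X Y, (X -> Y) -> mobj X -> mobj Y;
  mret : forall X, X -> mobj X;
  mjoin : forall X, mobj (mobj X) -> mobj X;
  mmap_id : forall X (a : mobj X), mmap id a = a;
  mmap_comp : forall X Y Z (g : Y -> Z) (f : X -> Y) (a : mobj X),
    mmap (g \o f) a = mmap g (mmap f a);
  mret_nat : forall X Y (f : X -> Y) (x : X), mmap f (mret x) = mret (f x);
  mjoin_nat : forall X Y (f : X -> Y) (a : mobj (mobj X)),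
    mmap f (mjoin a) = mjoin (mmap (mmap f) a);
  mjoin_retl : forall X (a : mobj X), mjoin (mret a) = a;
  mjoin_retr : forall X (a : mobj X), mjoin (mmap (@mret X) a) = a;
  mjoinA : forall X (a : mobj (mobj (mobj X))),
    mjoin (mjoin a) = mjoin (mmap (@mjoin X) a) }.

Arguments mret {m X} x.
Arguments mmap {m X Y} f a.
Arguments mjoin {m X} a.

Section Kleisli.
Variable M : monad.

Definition kl (X Y : Type) := X -> M Y.

Definition klid X : kl X X := mret.

Definition klcomp X Y Z (h : kl Y Z) (f : kl X Y) : kl X Z :=
  fun x => mjoin (mmap h (f x)).

Definition klpure X Y (f : X -> Y) : kl X Y := fun x => mret (f x).

(* The tensor product of Kleisli arrows given by the canonical strength of a monad on sets:
   bind a in f x, then b in g x', and return (a, b). *)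
Definition kltensor X Y X' Y' (f : kl X Y) (g : kl X' Y') :
    kl (X * X') (Y * Y') :=
  fun p => mjoin (mmap (fun a => mmap (fun b => (a, b)) (g p.2)) (f p.1)).

(* The composite of 1 = 1 * 1, the tensor product of f and g, and m. *)
Definition klconv E (m : kl (E * E) E) (f g : kl unit E) : kl unit E :=
  klcomp m (klcomp (kltensor f g) (klpure (fun t => (t, tt)))).

Lemma klcomp_idl X Y (f : kl X Y) : klcomp (@klid Y) f = f.
Proof. by apply/funext => x; rewrite /klcomp mjoin_retr. Qed.

Lemma klcomp_idr X Y (f : kl X Y) : klcomp f (@klid X) = f.
Proof. by apply/funext => x; rewrite /klcomp mret_nat mjoin_retl. Qed.

Lemma klcompA X Y Z W (h : kl Z W) (g : kl Y Z) (f : kl X Y) :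
  klcomp h (klcomp g f) = klcomp (klcomp h g) f.
Proof.
apply/funext => x; rewrite /klcomp mjoin_nat mjoinA -!mmap_comp.
by congr (mjoin (mmap _ _)).
Qed.
End Kleisli.

Arguments klid {M X} _.

Section Powerset.

Let pjoin X (A : set (set X)) : set X := \bigcup_(a in A) a.

Lemma pmap_id X (a : set X) : id @` a = a.
Proof. exact: image_id. Qed.

Lemma pmap_comp X Y Z (g : Y -> Z) (f : X -> Y) (a : set X) :
  (g \o f) @` a = g @` (f @` a).
Proof. by rewrite image_comp. Qed.

Lemma pret_nat X Y (f : X -> Y) (x : X) : f @` [set x] = [set f x].
Proof. exact: image_set1. Qed.

Lemma pjoin_nat X Y (f : X -> Y) (A : set (set X)) :
  f @` pjoin A = pjoin ((fun a => f @` a) @` A).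
Proof.
apply/seteqP; split=> [_ [x [a Aa ax] <-]|y [_ [a Aa <-] [x ax <-]]].
  by exists (f @` a); [exists a|exists x].
by exists x => //; exists a.
Qed.

Lemma pjoin_retl X (a : set X) : pjoin [set a] = a.
Proof. exact: bigcup_set1. Qed.

Lemma pjoin_retr X (a : set X) : pjoin (set1 @` a) = a.
Proof.
by apply/seteqP; split=> [x [_ [y ay <-] ->]|x ax] //; exists [set x]; [exists x|].
Qed.

Lemma pjoinA X (A : set (set (set X))) :
  pjoin (pjoin A) = pjoin (@pjoin X @` A).
Proof.
apply/seteqP; split=> [x [a [B AB Ba] ax]|x [_ [B AB <-] [a Ba ax]]].
  by exists (pjoin B); [exists B|exists a].
by exists a => //; exists B.
Qed.

Definition powerset_monad : monad :=
  @Monad set (fun X Y f a => f @` a) (fun X x => [set x])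
    (fun X A => \bigcup_(a in A) a)
    pmap_id pmap_comp pret_nat pjoin_nat pjoin_retl pjoin_retr pjoinA.

End Powerset.

Section PowersetKleisli.

Lemma pklcompE X Y Z (h : kl powerset_monad Y Z) (f : kl powerset_monad X Y) x z :
  klcomp h f x z <-> exists y, f x y /\ h y z.
Proof.
split=> [[_ [y fy <-] hz]|[y [fy hz]]]; first by exists y.
by exists (h y) => //; exists y.
Qed.

Lemma pkltensorE X Y X' Y' (f : kl powerset_monad X Y)
    (g : kl powerset_monad X' Y') p : kltensor f g p = f p.1 `*` g p.2.
Proof.
apply/seteqP; split=> [_ [_ [a fa <-] [b gb <-]]//|[a b] [fa gb]].
by exists [set (a, b') | b' in g p.2]; [exists a|exists b].
Qed.

Lemma pklconvE E (m : kl powerset_monad (E * E) E)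
    (f g : kl powerset_monad unit E) z :
  klconv m f g tt z <-> exists x y, [/\ f tt x, g tt y & m (x, y) z].
Proof.
split=> [/pklcompE[[x y] [/pklcompE[_ [-> +]] mz]]|[x [y [fx gy mz]]]].
  by rewrite pkltensorE => -[/= fx gy]; exists x, y.
apply/pklcompE; exists (x, y); split=> //.
by apply/pklcompE; exists (tt, tt); split=> //; rewrite pkltensorE.
Qed.

End PowersetKleisli.

Section PowersetConvolution.
Variable X : finType.

(* Hom(1, X * X) in the Kleisli category of the powerset monad, a monoid under
   Kleisli convolution. *)
Definition pH : Type := kl powerset_monad unit (X * X).

Definition pmul : kl powerset_monad ((X * X) * (X * X)) (X * X) :=
  fun p => if p.1.2 == p.2.1 then [set (p.1.1, p.2.2)] else set0.

Definition punit : pH := fun _ => [set (x, x) | x in [set: X]].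

Definition pconv (f g : pH) : pH := klconv pmul f g.

Lemma pH_ext (f g : pH) : (forall i j, f tt (i, j) <-> g tt (i, j)) -> f = g.
Proof. by move=> fg; apply/funext => -[]; apply/seteqP; split=> -[i j] /fg. Qed.

Lemma punitE i j : punit tt (i, j) <-> i = j.
Proof. by split=> [[x _ [-> ->]]|->] //; exists j. Qed.

Lemma pconvE (f g : pH) i q :
  pconv f g tt (i, q) <-> exists j, f tt (i, j) /\ g tt (j, q).
Proof.
split=> [/pklconvE[[a b] [[c d] [fab gcd]]]|[j [fij gjq]]].
  by rewrite /pmul /=; case: eqVneq => // <- in gcd * => -[-> ->]; exists b.
by apply/pklconvE; exists (i, j), (j, q); split; rewrite /pmul //= eqxx.
Qed.

Lemma pconvA : associative pconv.
Proof.
move=> f g h; apply: pH_ext => i q; rewrite !pconvE; split.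
  by move=> [j [fj /pconvE[l [gl hl]]]]; exists l; rewrite pconvE; split=> //; exists j.
by move=> [l [/pconvE[j [fj gl]] hl]]; exists j; rewrite pconvE; split=> //; exists l.
Qed.

Lemma pconv1f : left_id punit pconv.
Proof.
move=> f; apply: pH_ext => i q; rewrite pconvE.
by split=> [[j [/punitE -> //]]|fi]; exists i; rewrite punitE.
Qed.

Lemma pconvf1 : right_id punit pconv.
Proof.
move=> f; apply: pH_ext => i q; rewrite pconvE.
by split=> [[j [+ /punitE <- //]]|fi]; exists q; rewrite punitE.
Qed.

HB.instance Definition _ := gen_eqMixin pH.
HB.instance Definition _ := gen_choiceMixin pH.
HB.instance Definition _ := isMonoid.Build pH pconvA pconv1f pconvf1.

End PowersetConvolution.

Record pklcrep (G : groupType) := MkPklcrep {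
  pklcrep_set :> finType;
  pklcrep_hom : UMagmaMorphism.type G (pH pklcrep_set) }.

Section PowersetRepresentations.
Variable G : groupType.

Lemma pklcrep_perm_exists (R : pklcrep G) (g : G) :
  exists! s : {perm R}, pklcrep_hom R g tt = [set (s x, x) | x in [set: R]].
Proof.
set A := pklcrep_hom R g; set B := pklcrep_hom R g^-1%g.
have AB i q : (exists j, A tt (i, j) /\ B tt (j, q)) <-> i = q.
  by rewrite -pconvE -punitE -[pconv A B]/(A * B)%g -gmulfM mulgV gmulf1.
have BA i q : (exists j, B tt (i, j) /\ A tt (j, q)) <-> i = q.
  by rewrite -pconvE -punitE -[pconv B A]/(B * A)%g -gmulfM mulVg gmulf1.
have Aex x : exists i, A tt (i, x).
  by have [i [_ Aix]] := iffRL (BA x x) erefl; exists i.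
pose s x := projT1 (cid (Aex x)).
have As x : A tt (s x, x) by rewrite /s; case: cid.
have Auniq i x : A tt (i, x) -> i = s x.
  move=> Aix; have [j [Bj Aj]] := iffRL (BA x x) erefl.
  have -> : i = j by apply/AB; exists x.
  by apply/esym/AB; exists x.
have s_inj : injective s.
  move=> x y sxy; have [j [Aj Bj]] := iffRL (AB (s x) (s x)) erefl.
  have <- : j = x by apply/BA; exists (s x).
  by apply/BA; exists (s x); split=> //; rewrite sxy.
have AE : A tt = [set (perm s_inj x, x) | x in [set: R]].
  apply/seteqP; split=> [[i x] /Auniq ->|_ [x _ <-]]; last by rewrite permE.
  by exists x; rewrite ?permE.
exists (perm s_inj); split=> // t At; apply/permP => x; rewrite permE.
by apply/esym/Auniq; rewrite At; exists x.
Qed.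

(* The unique permutation s with rho(g)(tt) = {(s x, x) | x in R}. *)
Definition pklcrep_perm (R : pklcrep G) (g : G) : {perm R} :=
  projT1 (cid (pklcrep_perm_exists R g)).

Lemma pklcrep_permE (R : pklcrep G) (g : G) :
  pklcrep_hom R g tt = [set (pklcrep_perm R g x, x) | x in [set: R]].
Proof. by rewrite /pklcrep_perm; case: cid => s []. Qed.

Definition pklcrep_mor (R S : pklcrep G) : Type :=
  {f : R -> S | forall g x, f (pklcrep_perm R g x) = pklcrep_perm S g (f x)}.

Definition pklcrep_id (R : pklcrep G) : pklcrep_mor R R :=
  exist (fun f : R -> R => forall g x,
    f (pklcrep_perm R g x) = pklcrep_perm R g (f x)) id (fun _ _ => erefl).

Lemma pklcrep_comp_subproof (R S T : pklcrep G)
    (h : pklcrep_mor S T) (f : pklcrep_mor R S) g x :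
  (sval h \o sval f) (pklcrep_perm R g x) =
  pklcrep_perm T g ((sval h \o sval f) x).
Proof. by rewrite /= (svalP f) (svalP h). Qed.

Definition pklcrep_comp (R S T : pklcrep G)
    (h : pklcrep_mor S T) (f : pklcrep_mor R S) : pklcrep_mor R T :=
  exist _ (sval h \o sval f) (pklcrep_comp_subproof h f).

Definition Klcrep : precategory := Precategory pklcrep_id pklcrep_comp.

End PowersetRepresentations.

(* The product of {perm X} is in diagrammatic order, (s * t) x = t (s x), so
   multiplicativity for left actions is spelled out pointwise. *)
Record perm_rep (G : groupType) := PermRep {
  perm_rep_set :> finType;
  perm_rep_act : G -> {perm perm_rep_set};
  perm_rep_actM : forall g h x,
    perm_rep_act (g * h)%g x = perm_rep_act g (perm_rep_act h x) }.

Section PermutationRepresentations.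
Variable G : groupType.

Definition perm_rep_mor (X Y : perm_rep G) : Type :=
  {f : X -> Y | forall g x, f (perm_rep_act X g x) = perm_rep_act Y g (f x)}.

Definition perm_rep_id (X : perm_rep G) : perm_rep_mor X X :=
  exist (fun f : X -> X => forall g x,
    f (perm_rep_act X g x) = perm_rep_act X g (f x)) id (fun _ _ => erefl).

Lemma perm_rep_comp_subproof (X Y Z : perm_rep G)
    (h : perm_rep_mor Y Z) (f : perm_rep_mor X Y) g x :
  (sval h \o sval f) (perm_rep_act X g x) =
  perm_rep_act Z g ((sval h \o sval f) x).
Proof. by rewrite /= (svalP f) (svalP h). Qed.

Definition perm_rep_comp (X Y Z : perm_rep G)
    (h : perm_rep_mor Y Z) (f : perm_rep_mor X Y) : perm_rep_mor X Z :=
  exist _ (sval h \o sval f) (perm_rep_comp_subproof h f).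

Definition Perm : precategory := Precategory perm_rep_id perm_rep_comp.

Lemma Perm_is_category : is_category Perm.
Proof. by split=> * /=; apply: eq_sig_hprop => //= *; exact: Prop_irrelevance. Qed.

End PermutationRepresentations.

Section LinearExtension.
Variables (k : fieldType) (K : choiceType) (V : lmodType k).

Definition linext (F : K -> V) (a : {malg k[K]}) : V :=
  \sum_(x <- msupp a) a@_x *: F x.

Lemma linextw F (d : {fset K}) (a : {malg k[K]}) :
  (msupp a `<=` d)%fset -> linext F a = \sum_(x <- d) a@_x *: F x.
Proof.
move=> ad; apply: big_fset_incl => // x _ /mcoeff_outdom ->.
by rewrite scale0r.
Qed.

Lemma linext_is_linear F : linear (linext F).
Proof.
move=> c a b; pose d := (msupp a `|` msupp b `|` msupp (c *: a + b))%fset.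
have [da db dab] : [/\ (msupp a `<=` d)%fset, (msupp b `<=` d)%fset &
    (msupp (c *: a + b) `<=` d)%fset].
  split; apply/fsubsetP => x xa; rewrite !in_fsetE xa ?orbT //.
rewrite (linextw F da) (linextw F db) (linextw F dab) scaler_sumr -big_split /=.
by apply: eq_bigr => x _; rewrite mcoeffD mcoeffZ scalerDl scalerA.
Qed.

HB.instance Definition _ F :=
  GRing.isLinear.Build k {malg k[K]} V *:%R (linext F) (linext_is_linear F).

Lemma linextU F x : linext F << x >> = F x.
Proof.
rewrite (linextw F msuppU_le) big_seq_fset1.
by rewrite mcoeffUU scale1r.
Qed.

Lemma monalgZE (a : {malg k[K]}) : a = \sum_(x <- msupp a) a@_x *: << x >>.
Proof.
rewrite {1}[a]monalgE; apply: eq_bigr => x _; apply/malgP => y.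
by rewrite mcoeffZ !mcoeffU mulrnAr mulr1.
Qed.

Lemma eq_linear (L1 L2 : {linear {malg k[K]} -> V}) :
  (forall x, L1 << x >> = L2 << x >>) -> L1 =1 L2.
Proof.
move=> L12 a; rewrite [a]monalgZE !linear_sum; apply: eq_bigr => x _.
by rewrite !linearZ_LR L12.
Qed.

Lemma eq_linext F1 F2 : F1 =1 F2 -> linext F1 =1 linext F2.
Proof. by move=> F12 a; apply: eq_bigr => x _; rewrite F12. Qed.
End LinearExtension.

Lemma linear_linext (k : fieldType) (K : choiceType) (V W : lmodType k)
    (L : {linear V -> W}) (F : K -> V) a : L (linext F a) = linext (L \o F) a.
Proof. by rewrite linear_sum; apply: eq_bigr => x _; rewrite linearZ_LR. Qed.

Lemma linext_ret (k : fieldType) (K : choiceType) (a : {malg k[K]}) :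
  linext (fun x => << x >>) a = a.
Proof. by rewrite [RHS]monalgZE. Qed.

Section FreeModule.
Variable k : fieldType.

(* {classic X} equips an arbitrary set X with the choice structure required by
   {malg _[_]}, the finitely supported functions. *)
Definition free_mod (X : Type) := {malg k[{classic X}]}.

Definition fm_coef X (a : free_mod X) (x : X) : k := a@_(x : {classic X}).

Definition fm_ret X (x : X) : free_mod X := << (x : {classic X}) >>.

Definition fm_map X Y (f : X -> Y) : free_mod X -> free_mod Y :=
  linext (fun x : {classic X} => fm_ret (f x)).

Definition fm_join X : free_mod (free_mod X) -> free_mod X :=
  linext (fun a : {classic free_mod X} => a : {malg k[{classic X}]}).

Lemma fm_map_id X (a : free_mod X) : fm_map id a = a.
Proof. exact: linext_ret. Qed.

Lemma fm_map_comp X Y Z (g : Y -> Z) (f : X -> Y) (a : free_mod X) :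
  fm_map (g \o f) a = fm_map g (fm_map f a).
Proof. by rewrite /fm_map linear_linext; apply: eq_linext => x /=; rewrite linextU. Qed.

Lemma fm_ret_nat X Y (f : X -> Y) (x : X) :
  fm_map f (fm_ret x) = fm_ret (f x).
Proof. exact: linextU. Qed.

Lemma fm_join_nat X Y (f : X -> Y) (a : free_mod (free_mod X)) :
  fm_map f (fm_join a) = fm_join (fm_map (fm_map f) a).
Proof.
by rewrite /fm_join /fm_map !linear_linext; apply: eq_linext => x /=; rewrite linextU.
Qed.

Lemma fm_join_retl X (a : free_mod X) : fm_join (fm_ret a) = a.
Proof. exact: linextU. Qed.

Lemma fm_join_retr X (a : free_mod X) : fm_join (fm_map (@fm_ret X) a) = a.
Proof.
rewrite /fm_join /fm_map linear_linext -[RHS]linext_ret.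
by apply: eq_linext => x /=; rewrite linextU.
Qed.

Lemma fm_joinA X (a : free_mod (free_mod (free_mod X))) :
  fm_join (fm_join a) = fm_join (fm_map (@fm_join X) a).
Proof.
by rewrite /fm_join /fm_map !linear_linext; apply: eq_linext => x /=; rewrite linextU.
Qed.

Definition free_mod_monad : monad :=
  @Monad free_mod fm_map fm_ret fm_join
    fm_map_id fm_map_comp fm_ret_nat fm_join_nat
    fm_join_retl fm_join_retr fm_joinA.

(* Kleisli arrows are added and scaled pointwise, hence as their matrices: see
   kmx_linear. *)
Definition kkl (X Y : Type) : Type := kl free_mod_monad X Y.

HB.instance Definition _ X Y :=
  GRing.Lmodule.copy (kkl X Y) (X -> {malg k[{classic Y}]}).

Lemma kklcompE X Y Z (h : kkl Y Z) (f : kkl X Y) x :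
  klcomp h f x = linext (h : {classic Y} -> {malg k[{classic Z}]}) (f x).
Proof.
rewrite /klcomp /= /fm_join /fm_map /fm_ret linear_linext.
by apply: eq_linext => y /=; rewrite linextU.
Qed.

Lemma kkltensorE X Y X' Y' (f : kkl X Y) (g : kkl X' Y') p :
  kltensor f g p =
  linext (fun a : {classic Y} =>
    linext (fun b : {classic Y'} => << ((a, b) : {classic Y * Y'}) >>) (g p.2))
    (f p.1) :> {malg k[{classic Y * Y'}]}.
Proof.
rewrite /kltensor /= /fm_join /fm_map /fm_ret linear_linext.
by apply: eq_linext => y /=; rewrite linextU.
Qed.

Lemma kklconvE E (m : kkl (E * E) E) (f g : kkl unit E) :
  klconv m f g tt =
  linext (fun a : {classic E} =>
    linext (fun b : {classic E} => m (a, b) : {malg k[{classic E}]}) (g tt))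
    (f tt) :> {malg k[{classic E}]}.
Proof.
rewrite /klconv kklcompE kklcompE /klpure /= /fm_ret linextU kkltensorE linear_linext.
apply: eq_linext => a /=; rewrite linear_linext.
by apply: eq_linext => b /=; rewrite linextU.
Qed.

Lemma linext_fin (X : finType) (V : lmodType k) (F : {classic X} -> V) a :
  linext F a = \sum_(x : X) a@_(x : {classic X}) *: F x.
Proof.
pose L a := \sum_(x : X) a@_(x : {classic X}) *: F x.
have Llin : linear L.
  move=> c b d; rewrite /L scaler_sumr -big_split; apply: eq_bigr => x _ /=.
  by rewrite mcoeffD mcoeffZ scalerDl scalerA.
pose LL := HB.pack_for {linear {malg k[{classic X}]} -> V} L
  (GRing.isLinear.Build k {malg k[{classic X}]} V *:%R L Llin).
apply: (@eq_linear k _ V (linext F) LL) => x; rewrite [LHS]linextU /= /L.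
rewrite (bigD1 (x : X)) //= mcoeffUU scale1r big1 ?addr0 // => y yx.
rewrite mcoeffU; case: eqP => [xy|_]; last by rewrite mulr0n scale0r.
by rewrite xy eqxx in yx.
Qed.

(* The matrix (f_{y,x}) of f, its rows and columns being numbered along the
   enumerations of Y and X; likewise in Phi. *)
Definition kmx (X Y : finType) (f : kkl X Y) : 'M[k]_(#|Y|, #|X|) :=
  \matrix_(i, j) fm_coef (f (enum_val j)) (enum_val i).

Lemma kmx_inj (X Y : finType) : injective (@kmx X Y).
Proof.
move=> f g /matrixP fg; apply/funext => x; apply/malgP => y.
by have := fg (enum_rank (y : Y)) (enum_rank x); rewrite !mxE /fm_coef !enum_rankK.
Qed.

Lemma kmx_linear (X Y : finType) : linear (@kmx X Y).
Proof. by move=> c f g; apply/matrixP => i j; rewrite !mxE /fm_coef mcoeffD mcoeffZ. Qed.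

Lemma kmx0 (X Y : finType) : kmx (0 : kkl X Y) = 0.
Proof. by apply/matrixP => i j; rewrite !mxE /fm_coef mcoeff0. Qed.

Lemma kmx_id (X : finType) : kmx (klid : kkl X X) = 1%:M.
Proof.
apply/matrixP => i j; rewrite !mxE /fm_coef mcoeffU; congr (_%:R); congr nat_of_bool.
by apply/eqP/eqP => [/enum_val_inj|] ->.
Qed.

Lemma kmx_comp (X Y Z : finType) (h : kkl Y Z) (f : kkl X Y) :
  kmx (klcomp h f : kkl X Z) = kmx h *m kmx f.
Proof.
apply/matrixP => i j; rewrite !mxE /fm_coef kklcompE linext_fin raddf_sum /=.
rewrite (reindex _ (onW_bij _ (enum_val_bij Y))) /=; apply: eq_bigr => l _.
by rewrite !mxE /fm_coef mcoeffZ mulrC.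
Qed.

Section Convolution.
Variable X : finType.

(* Hom(1, X * X) in the Kleisli category of the free module monad, a k-algebra
   under Kleisli convolution. It is the zero ring when X is empty, whence a
   pzRingType only. *)
Definition kH : Type := kkl unit (X * X).

Definition kmul : kkl ((X * X) * (X * X)) (X * X) :=
  fun p => if p.1.2 == p.2.1 then fm_ret (p.1.1, p.2.2) else 0.

Definition kunit : kH :=
  fun _ => \sum_(x : X) (fm_ret (x, x) : {malg k[{classic X * X}]}).

Definition kconv (f g : kH) : kH := klconv kmul f g.

Definition Phi (f : kH) : 'M[k]_#|X| :=
  \matrix_(i, j) fm_coef (f tt) (enum_val i, enum_val j).

HB.instance Definition _ := GRing.Lmodule.copy kH (kkl unit (X * X)).

Lemma Phi_inj : injective Phi.
Proof.
move=> f g /matrixP fg; apply/funext => -[]; apply/malgP => -[x y].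
by have := fg (enum_rank x) (enum_rank y); rewrite !mxE /fm_coef !enum_rankK.
Qed.

Lemma Phi_linear : linear Phi.
Proof. by move=> c f g; apply/matrixP => i j; rewrite !mxE /fm_coef mcoeffD mcoeffZ. Qed.

Lemma Phi1 : Phi kunit = 1%:M.
Proof.
apply/matrixP => i j; rewrite !mxE /fm_coef raddf_sum /= (bigD1 (enum_val i)) //= mcoeffU.
rewrite big1 ?addr0 => [|x xi].
  congr (_%:R); congr nat_of_bool.
  by apply/eqP/eqP => [[/enum_val_inj]|->].
rewrite mcoeffU; case: eqP => // -[xi' _].
by rewrite xi' eqxx in xi.
Qed.

Lemma kconvE f g i q :
  fm_coef (kconv f g tt) (i, q) =
  \sum_j fm_coef (f tt) (i, j) * fm_coef (g tt) (j, q).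
Proof.
rewrite /fm_coef /kconv kklconvE linext_fin raddf_sum /=.
have inner u v : \sum_(b : X * X) (g tt)@_(b : {classic X * X}) *
    fm_coef (kmul ((u, v), b)) (i, q) =
    if u == i then (g tt)@_((v, q) : {classic X * X}) else 0.
  rewrite /fm_coef (bigD1 (v, q)) //= big1 ?addr0 => [|[w z] wz].
    rewrite /kmul /= eqxx mcoeffU; have [->|ui] := eqVneq u i.
      by rewrite eqxx mulr1.
    by case: eqP => [[/eqP]|_]; rewrite ?(negPf ui) ?mulr0.
  rewrite /kmul /=; case: eqVneq => [vw|_]; last by rewrite mcoeff0 mulr0.
  rewrite mcoeffU; case: eqP => [[_ zq]|_]; last by rewrite mulr0.
  by rewrite vw zq eqxx in wz.
rewrite (eq_bigr (fun a : X * X => if a.1 == i then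
    (f tt)@_((a.1, a.2) : {classic X * X}) *
    (g tt)@_((a.2, q) : {classic X * X}) else 0)) => [|[u v] _]; last first.
  rewrite mcoeffZ linext_fin raddf_sum /=.
  under eq_bigr do rewrite mcoeffZ.
  by rewrite [X in _ * X]inner; case: ifP; rewrite ?mulr0.
rewrite -(pair_bigA _ (fun u v => if u == i then
    (f tt)@_((u, v) : {classic X * X}) *
    (g tt)@_((v, q) : {classic X * X}) else 0)) /=.
rewrite (bigD1 i) //= [X in _ + X]big1 ?addr0 => [|u /negPf ->]; last exact: big1.
by apply: eq_bigr => v _; rewrite eqxx.
Qed.

Lemma PhiM f g : Phi (kconv f g) = Phi f *m Phi g.
Proof.
apply/matrixP => i j; rewrite !mxE kconvE.
rewrite (reindex _ (onW_bij _ (enum_val_bij X))) /=.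
by apply: eq_bigr => l _; rewrite !mxE /fm_coef.
Qed.

Lemma kconvA : associative kconv.
Proof.
move=> f g h; apply: Phi_inj.
by have := mulmxA (Phi f) (Phi g) (Phi h); rewrite -!PhiM.
Qed.

Lemma kconv1f : left_id kunit kconv.
Proof.
by move=> f; apply: Phi_inj; have := mul1mx (Phi f); rewrite -Phi1 -PhiM.
Qed.

Lemma kconvf1 : right_id kunit kconv.
Proof.
by move=> f; apply: Phi_inj; have := mulmx1 (Phi f); rewrite -Phi1 -PhiM.
Qed.

Lemma PhiD f g : Phi (f + g) = Phi f + Phi g.
Proof. by apply/matrixP => i j; rewrite !mxE /fm_coef mcoeffD. Qed.

Lemma kconvDl : left_distributive kconv +%R.
Proof.
move=> f g h; apply: Phi_inj.
by have := mulmxDl (Phi f) (Phi g) (Phi h); rewrite -PhiD -!PhiM -PhiD.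
Qed.

Lemma kconvDr : right_distributive kconv +%R.
Proof.
move=> f g h; apply: Phi_inj.
by have := mulmxDr (Phi f) (Phi g) (Phi h); rewrite -PhiD -!PhiM -PhiD.
Qed.

HB.instance Definition _ :=
  GRing.Zmodule_isPzRing.Build kH kconvA kconv1f kconvf1 kconvDl kconvDr.

End Convolution.

End FreeModule.

Section GroupAlgebra.
Variables (k : fieldType) (G : groupType).

(* The product of {malg k[_]} in the library is restricted to monoids with no
   nontrivial unit, hence does not apply to groups. *)
Definition group_algebra : Type := {malg k[G]}.

HB.instance Definition _ := GRing.Lmodule.copy group_algebra {malg k[G]}.

Definition gabas (g : G) : group_algebra := << g >>.

Definition gamul (a b : group_algebra) : group_algebra :=
  linext (fun g => linext (fun h => gabas (g * h)%g) b) a.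

Lemma gamulUU g h : gamul (gabas g) (gabas h) = gabas (g * h)%g.
Proof. by rewrite /gamul !linextU. Qed.

Lemma gamul_linearl b : linear (gamul^~ b).
Proof. by move=> c a a'; rewrite /gamul linearP. Qed.

Lemma gamul_linearr a : linear (gamul a).
Proof.
move=> c b b'; rewrite /gamul [linext _ a]/linext scaler_sumr -big_split /=.
by apply: eq_bigr => g _; rewrite linearP scalerDr !scalerA mulrC.
Qed.

Lemma gamulA : associative gamul.
Proof.
move=> a b c; rewrite /gamul linear_linext; apply: eq_linext => g /=.
rewrite !linear_linext; apply: eq_linext => h /=.
rewrite linextU linear_linext; apply: eq_linext => l /=.
by rewrite linextU mulgA.
Qed.

Lemma gamul1a : left_id (gabas 1%g) gamul.
Proof.
move=> a; rewrite /gamul linextU -[RHS]linext_ret.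
by apply: eq_linext => g; rewrite mul1g.
Qed.

Lemma gamula1 : right_id (gabas 1%g) gamul.
Proof.
move=> a; rewrite /gamul -[RHS]linext_ret.
by apply: eq_linext => g; rewrite linextU mulg1.
Qed.

Lemma gamulDl : left_distributive gamul +%R.
Proof. by move=> a b c; have := gamul_linearl c 1 a b; rewrite !scale1r. Qed.

Lemma gamulDr : right_distributive gamul +%R.
Proof. by move=> a b c; have := gamul_linearr a 1 b c; rewrite !scale1r. Qed.

Lemma gaone_neq0 : gabas 1%g != 0.
Proof. by rewrite /gabas monalgU_eq0 oner_eq0. Qed.

HB.instance Definition _ := GRing.Zmodule_isNzRing.Build group_algebra
  gamulA gamul1a gamula1 gamulDl gamulDr gaone_neq0.

Lemma gamulZl (c : k) (a b : group_algebra) : c *: (a * b) = (c *: a) * b.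
Proof. by have := gamul_linearl b c a 0; rewrite /gamul !addr0 linear0 addr0. Qed.

Lemma gamulZr (c : k) (a b : group_algebra) : c *: (a * b) = a * (c *: b).
Proof.
have := gamul_linearr a (-1) 0 0; rewrite scaler0 addr0 scaleN1r addNr => a0.
by have := gamul_linearr a c b 0; rewrite addr0 a0 addr0.
Qed.

HB.instance Definition _ :=
  GRing.LSemiModule_isLSemiAlgebra.Build k group_algebra gamulZl.
HB.instance Definition _ :=
  GRing.LSemiAlgebra_isSemiAlgebra.Build k group_algebra gamulZr.

End GroupAlgebra.

Record lklcrep (k : fieldType) (G : groupType) := MkLklcrep {
  lklcrep_set :> finType;
  lklcrep_hom : {lrmorphism group_algebra k G -> kH k lklcrep_set} }.

Section LinearKleisliRepresentations.
Variables (k : fieldType) (G : groupType).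

Definition lklcrep_intertwining (R S : lklcrep k G) : {pred kkl k R S} :=
  fun f => `[< forall a : group_algebra k G,
    Phi (lklcrep_hom S a) *m kmx f = kmx f *m Phi (lklcrep_hom R a) >].

Arguments lklcrep_intertwining : clear implicits.

Lemma lklcrep_intertwining_submod (R S : lklcrep k G) :
  submod_closed (lklcrep_intertwining R S).
Proof.
split=> [|c f g /asboolP fP /asboolP gP]; apply/asboolP => a.
  by rewrite kmx0 mulmx0 mul0mx.
by rewrite kmx_linear mulmxDr mulmxDl -scalemxAl -scalemxAr fP gP.
Qed.

HB.instance Definition _ (R S : lklcrep k G) := GRing.isSubmodClosed.Build k (kkl k R S)
  (lklcrep_intertwining R S) (lklcrep_intertwining_submod R S).

Record lklcrep_mor (R S : lklcrep k G) := LKlcrepMor {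
  lklcrep_mor_val :> kkl k R S;
  _ : lklcrep_mor_val \in lklcrep_intertwining R S }.

HB.instance Definition _ R S := [isSub for @lklcrep_mor_val R S].
HB.instance Definition _ R S := [Choice of lklcrep_mor R S by <:].
HB.instance Definition _ R S :=
  [SubChoice_isSubLmodule of lklcrep_mor R S by <:].

Lemma lklcrep_id_subproof (R : lklcrep k G) :
  (klid : kkl k R R) \in lklcrep_intertwining R R.
Proof. by apply/asboolP => a; rewrite kmx_id mulmx1 mul1mx. Qed.

Definition lklcrep_id (R : lklcrep k G) : lklcrep_mor R R :=
  LKlcrepMor (lklcrep_id_subproof R).

Lemma lklcrep_comp_subproof (R S T : lklcrep k G)
    (h : lklcrep_mor S T) (f : lklcrep_mor R S) :
  (klcomp (h : kkl k S T) (f : kkl k R S) : kkl k R T) \in lklcrep_intertwining R T.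
Proof.
have /asboolP hP := valP h; have /asboolP fP := valP f; apply/asboolP => a.
by rewrite kmx_comp mulmxA hP -mulmxA fP mulmxA.
Qed.

Definition lklcrep_comp (R S T : lklcrep k G)
    (h : lklcrep_mor S T) (f : lklcrep_mor R S) : lklcrep_mor R T :=
  LKlcrepMor (lklcrep_comp_subproof h f).

Definition LKlcrep : lprecategory k :=
  @LPrecategory k (lklcrep k G) (fun R S => lklcrep_mor R S)
    lklcrep_id lklcrep_comp.

End LinearKleisliRepresentations.

(* In finite dimension, an endomorphism is in GL(V) when its kernel is null. *)
Record lin_rep (k : fieldType) (G : groupType) := LinRep {
  lin_rep_space :> vectType k;
  lin_rep_act : G -> 'End(lin_rep_space);
  lin_rep_GL : forall g, lker (lin_rep_act g) == 0%VS;
  lin_rep_actM : forall g h,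
    lin_rep_act (g * h)%g = (lin_rep_act g \o lin_rep_act h)%VF }.

Section LinearRepresentations.
Variables (k : fieldType) (G : groupType).

Definition lin_rep_equivariant (V W : lin_rep k G) : {pred 'Hom(V, W)} :=
  fun f => `[< forall g v, f (lin_rep_act V g v) = lin_rep_act W g (f v) >].

Arguments lin_rep_equivariant : clear implicits.

Lemma lin_rep_equivariant_submod (V W : lin_rep k G) :
  submod_closed (lin_rep_equivariant V W).
Proof.
split=> [|c f g /asboolP fP /asboolP gP]; apply/asboolP => x v.
  by rewrite !zero_lfunE linear0.
by rewrite !add_lfunE !scale_lfunE linearP fP gP.
Qed.

HB.instance Definition _ (V W : lin_rep k G) := GRing.isSubmodClosed.Build k 'Hom(V, W)
  (lin_rep_equivariant V W) (lin_rep_equivariant_submod V W).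

Record lin_rep_mor (V W : lin_rep k G) := LinRepMor {
  lin_rep_mor_val :> 'Hom(V, W);
  _ : lin_rep_mor_val \in lin_rep_equivariant V W }.

HB.instance Definition _ V W := [isSub for @lin_rep_mor_val V W].
HB.instance Definition _ V W := [Choice of lin_rep_mor V W by <:].
HB.instance Definition _ V W :=
  [SubChoice_isSubLmodule of lin_rep_mor V W by <:].

Lemma lin_rep_id_subproof (V : lin_rep k G) :
  \1%VF \in lin_rep_equivariant V V.
Proof. by apply/asboolP => g v; rewrite !id_lfunE. Qed.

Definition lin_rep_id (V : lin_rep k G) : lin_rep_mor V V :=
  LinRepMor (lin_rep_id_subproof V).

Lemma lin_rep_comp_subproof (U V W : lin_rep k G)
    (h : lin_rep_mor V W) (f : lin_rep_mor U V) :
  (h \o f)%VF \in lin_rep_equivariant U W.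
Proof.
have /asboolP hP := valP h; have /asboolP fP := valP f; apply/asboolP => g v.
by rewrite !comp_lfunE fP hP.
Qed.

Definition lin_rep_comp (U V W : lin_rep k G)
    (h : lin_rep_mor V W) (f : lin_rep_mor U V) : lin_rep_mor U W :=
  LinRepMor (lin_rep_comp_subproof h f).

Definition Rep : lprecategory k :=
  @LPrecategory k (lin_rep k G) (fun V W => lin_rep_mor V W)
    lin_rep_id lin_rep_comp.

Lemma Rep_is_linear_category : is_linear_category Rep.
Proof.
split=> [|U V W f c h h'|U V W h c f f'].
- split=> *; apply: val_inj => /=.
  + exact: comp_lfun1l.
  + exact: comp_lfun1r.
  + exact: comp_lfunA.
- by apply: val_inj; rewrite /= comp_lfunDl comp_lfunZl.
- by apply: val_inj; rewrite /= comp_lfunDr comp_lfunZr.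
Qed.

End LinearRepresentations.

(* Main.v *)
From HB Require Import structures.
From mathcomp Require Import all_boot all_algebra.
From mathcomp Require Import fingroup perm.
From mathcomp Require Import boolp classical_sets.
From mathcomp.multinomials Require Import monalg.
Require Import Defs.

Set Implicit Arguments.
Unset Strict Implicit.
Unset Printing Implicit Defensive.

Import GRing.Theory VectorInternalTheory.
Local Open Scope ring_scope.

(** Both equivalences come from one principle: a functor that is faithful, full
    and essentially surjective has a quasi-inverse.  The categories of finite
    G-sets and of linear representations are known to be categories, and a
    faithful functor reflects the category laws and the bilinearity of the
    composition, so that the functors constructed here also show that the
    Kleisli convolution representations form categories
    ([faithful_is_category], [faithful_is_linear_category]).  A quasi-inverse
    of a linear functor is automatically linear, because up to that functor it
    is conjugation by isomorphisms ([fully_faithful_quasi_inverse]).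

    For the powerset monad, send a representation to the family of its
    permutations.  These multiply as relations do, so this is a G-set, and the
    morphisms on both sides are the same maps.  Conversely the graphs of the
    permutations of a G-set form a convolution representation, which the
    functor sends back to the G-set one started from.

    For the free module monad, send the representation on X to the space of
    column vectors indexed by X, on which g acts by the matrix of its image
    ([LKlcrep_to_Rep]), and a Kleisli arrow to the multiplication by its
    matrix.  The functor is faithful because a Kleisli arrow is determined by
    its matrix and a matrix by its products with columns.  It is full because
    every linear map of column spaces is a matrix, every matrix is that of a
    Kleisli arrow, and commuting with the group elements amounts to commuting
    with the group algebra that they span ([lklcrep_intertwiningP]).  It is
    essentially surjective because coordinates on V turn the action into
    matrices, that is, into elements of the convolution algebra, and a
    multiplicative map on G that preserves 1 extends to the group algebra
    ([group_algebra_extend]). *)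

(** * Fully faithful functors and equivalences *)

Section Functors.
Variables (C D : precategory) (F : functor C D).

Definition faithful : Prop :=
  forall x y : C, injective (fmor F : hom x y -> hom (F x) (F y)).

Definition full : Prop :=
  forall (x y : C) (h : hom (F x) (F y)), exists f : hom x y, fmor F f = h.

Definition essentially_surjective : Prop :=
  forall y : D, exists (x : C) (e : hom (F x) y), is_iso e.

(** The two sides of each law have the same image, by the law that holds in
    the target. *)
Lemma faithful_is_category : faithful -> is_category D -> is_category C.
Proof.
move=> Finj [D1f Df1 DA]; split=> *; apply: Finj; rewrite !fmor_comp ?fmor_id.
- exact: D1f.
- exact: Df1.
- exact: DA.
Qed.

(** Choose for each y an isomorphism e_y from the image of some object G y, and
    let G h be the unique arrow above the conjugate of h by these
    isomorphisms.  The second conclusion retains that F (G h) is this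
    conjugate: it gives the linearity of G when F is linear. *)
Lemma fully_faithful_quasi_inverse :
    is_category D -> faithful -> full -> essentially_surjective ->
  exists G : functor D C, quasi_inverse F G /\
    forall x y : D, exists a b, forall h : hom x y,
      fmor F (fmor G h) = comp a (comp h b).
Proof.
move=> [D1f Df1 DA] Finj Ffull Fsurj.
have inverse (y : D) : {x : C & {e : hom (F x) y & {e' : hom y (F x) |
    comp e' e = idm (F x) /\ comp e e' = idm y}}}.
  have [x /cid[e /cid[e' e'K]]] := cid (Fsurj y).
  by exists x, e, e'.
pose g y := projT1 (inverse y).
pose e y : hom (F (g y)) y := projT1 (projT2 (inverse y)).
pose e' y : hom y (F (g y)) := sval (projT2 (projT2 (inverse y))).
have e'K y : comp (e' y) (e y) = idm _.
  by rewrite /e' /e; case: (projT2 (projT2 (inverse y))) => ? [].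
have eK y : comp (e y) (e' y) = idm _.
  by rewrite /e' /e; case: (projT2 (projT2 (inverse y))) => ? [].
pose lift x y (h : hom (F x) (F y)) : hom x y := sval (cid (Ffull x y h)).
have liftK x y (h : hom (F x) (F y)) : fmor F (lift x y h) = h.
  by rewrite /lift; case: cid.
pose gmor x y (h : hom x y) := lift (g x) (g y) (comp (e' y) (comp h (e x))).
have gid x : gmor x x (idm x) = idm (g x).
  by apply: Finj; rewrite liftK D1f e'K fmor_id.
have gcomp x y z (h : hom y z) (f : hom x y) :
    gmor x z (comp h f) = comp (gmor y z h) (gmor x y f).
  apply: Finj; rewrite fmor_comp !liftK -!DA; congr (comp _ (comp _ _)).
  by rewrite !DA eK D1f.
exists (Functor gid gcomp); split; last first.
  by move=> x y; exists (e' y), (e x) => h; rewrite liftK.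
split.
(* The isomorphism G (F x) -> x is the one above e_(F x). *)
- exists (fun x => lift (g (F x)) x (e (F x))); split=> [x|x y f] /=.
    exists (lift x (g (F x)) (e' (F x))).
    by split; apply: Finj; rewrite fmor_comp !liftK fmor_id.
  by apply: Finj; rewrite !fmor_comp !liftK !DA eK D1f.
- exists e; split=> [y|x y h] /=; first by exists (e' y).
  by rewrite liftK !DA eK D1f.
Qed.

Lemma fully_faithful_equivalent :
    is_category D -> faithful -> full -> essentially_surjective ->
  equivalent C D.
Proof.
move=> catD Finj Ffull Fsurj.
have [G [FG _]] := fully_faithful_quasi_inverse catD Finj Ffull Fsurj.
by exists F, G.
Qed.

End Functors.

Section LinearFunctors.
Variables (k : fieldType) (C D : lprecategory k) (F : functor C D).
Hypotheses (catD : is_linear_category D) (Flin : linear_functor F).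
Hypothesis Finj : faithful F.

Lemma faithful_is_linear_category : is_linear_category C.
Proof.
have [Dcat Dl Dr] := catD.
split=> [|x y z f c h h'|x y z h c f f']; first exact: faithful_is_category Dcat.
  have FM (u : lhom y z) : fmor F (lcomp u f) = lcomp (fmor F u) (fmor F f).
    exact: fmor_comp.
  by apply: Finj; rewrite FM !Flin Dl !FM.
have FM (u : lhom x y) : fmor F (lcomp h u) = lcomp (fmor F h) (fmor F u).
  exact: fmor_comp.
by apply: Finj; rewrite FM !Flin Dr !FM.
Qed.

Lemma fully_faithful_linearly_equivalent :
  full F -> essentially_surjective F -> linearly_equivalent C D.
Proof.
have [Dcat Dl Dr] := catD.
move=> Ffull Fsurj.
have [G [FG Gconj]] := fully_faithful_quasi_inverse Dcat Finj Ffull Fsurj.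
exists F, G; split=> // x y c h h'; apply: Finj.
have [a [b FGab]] := Gconj x y.
have FGE (u : lhom x y) : fmor F (fmor G u) = lcomp a (lcomp u b).
  exact: FGab.
by rewrite Flin !FGE Dl Dr.
Qed.

End LinearFunctors.

(** * Representations over the powerset monad *)

Section PermutationRepresentations.
Local Open Scope classical_set_scope.
Variable G : groupType.

Lemma pklcrep_perm_unique (R : pklcrep G) g (s : {perm R}) :
  pklcrep_hom R g tt = [set (s x, x) | x in [set: R]] -> pklcrep_perm R g = s.
Proof.
move=> sE; have [t [_ t_uniq]] := pklcrep_perm_exists R g.
by rewrite -(t_uniq _ sE) -(t_uniq _ (pklcrep_permE R g)).
Qed.

Definition graph_pH (X : finType) (s : {perm X}) : pH X :=
  fun _ => [set (s x, x) | x in [set: X]].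

Lemma graph_pHE (X : finType) (s : {perm X}) i j :
  graph_pH s tt (i, j) <-> i = s j.
Proof. by split=> [[x _ [<- <-]]|->] //; exists j. Qed.

(** Convolution is composition of relations, whereas the product of
    permutations applies its left factor first: hence the exchange of the
    factors. *)
Lemma pconv_graph (X : finType) (s t : {perm X}) :
  pconv (graph_pH s) (graph_pH t) = graph_pH (t * s)%g.
Proof.
apply: pH_ext => i q; rewrite pconvE graph_pHE permM.
split=> [[j [/graph_pHE -> /graph_pHE -> //]]|->].
by exists (t q); split; apply/graph_pHE.
Qed.

Lemma graph_pH1 (X : finType) : graph_pH (1%g : {perm X}) = @punit X.
Proof. by apply: pH_ext => i j; rewrite graph_pHE perm1 punitE. Qed.

Lemma pklcrep_perm_actM (R : pklcrep G) g h x :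
  pklcrep_perm R (g * h)%g x = pklcrep_perm R g (pklcrep_perm R h x).
Proof.
rewrite -permM; congr (fun_of_perm _ x); apply: pklcrep_perm_unique.
rewrite gmulfM -[RHS]/(graph_pH _ tt) -pconv_graph.
congr (pconv _ _ tt); apply/funext => -[]; exact: pklcrep_permE.
Qed.

Definition pklcrep_perm_rep (R : pklcrep G) : perm_rep G :=
  PermRep (@pklcrep_perm_actM R).

(* The two composites have the same underlying map, but carry different proofs
   of equivariance. *)
Let Klcrep_to_Perm_comp (R S T : Klcrep G) (h : hom S T) (f : hom R S) :
  comp h f = @comp (Perm G) (pklcrep_perm_rep R) (pklcrep_perm_rep S)
    (pklcrep_perm_rep T) h f.
Proof. by apply: eq_sig_hprop => //= *; exact: Prop_irrelevance. Qed.

Definition Klcrep_to_Perm : functor (Klcrep G) (Perm G) :=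
  @Functor (Klcrep G) (Perm G) pklcrep_perm_rep (fun _ _ => id)
    (fun _ => erefl) Klcrep_to_Perm_comp.

(** Multiplicativity suffices: the permutation of 1 is idempotent and
    injective. *)
Lemma perm_rep_act1 (X : perm_rep G) : perm_rep_act X 1%g = 1%g.
Proof.
apply/permP => x; rewrite perm1.
by apply: (@perm_inj _ (perm_rep_act X 1%g)); rewrite -perm_rep_actM mulg1.
Qed.

Section Graph.
Variable X : perm_rep G.

Let graph (g : G) : pH X := graph_pH (perm_rep_act X g).

Let graph_monoid_morphism :
  (graph 1%g = 1%g) * {morph graph : g h / (g * h)%g}.
Proof.
split=> [|g h]; first by rewrite /graph perm_rep_act1 graph_pH1.
rewrite [RHS]pconv_graph; congr graph_pH.
by apply/permP => x; rewrite permM perm_rep_actM.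
Qed.

Definition perm_rep_pklcrep : pklcrep G :=
  MkPklcrep (HB.pack_for (UMagmaMorphism.type G (pH X)) graph
    (isUMagmaMorphism.Build G (pH X) graph graph_monoid_morphism)).

Lemma perm_rep_pklcrepE g : pklcrep_perm perm_rep_pklcrep g = perm_rep_act X g.
Proof. exact: pklcrep_perm_unique. Qed.

End Graph.

Lemma Klcrep_to_Perm_faithful : faithful Klcrep_to_Perm.
Proof. by move=> R S f g. Qed.

Lemma Klcrep_to_Perm_full : full Klcrep_to_Perm.
Proof. by move=> R S h; exists h. Qed.

Lemma Klcrep_to_Perm_essentially_surjective :
  essentially_surjective Klcrep_to_Perm.
Proof.
move=> X; exists (perm_rep_pklcrep X).
have idP g x : pklcrep_perm (perm_rep_pklcrep X) g x = perm_rep_act X g x.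
  by rewrite perm_rep_pklcrepE.
have idV g x : perm_rep_act X g x = pklcrep_perm (perm_rep_pklcrep X) g x.
  by rewrite perm_rep_pklcrepE.
exists (exist _ id idP), (exist _ id idV).
by split; apply: eq_sig_hprop => //= *; exact: Prop_irrelevance.
Qed.

Lemma Klcrep_is_category : is_category (Klcrep G).
Proof.
exact: faithful_is_category Klcrep_to_Perm_faithful (@Perm_is_category G).
Qed.

Lemma Klcrep_equivalent_Perm : equivalent (Klcrep G) (Perm G).
Proof.
exact: fully_faithful_equivalent (@Perm_is_category G) Klcrep_to_Perm_faithful
  Klcrep_to_Perm_full Klcrep_to_Perm_essentially_surjective.
Qed.

End PermutationRepresentations.

(** * Kleisli arrows as matrices *)

Section Matrices.
Variable k : fieldType.

Lemma linear_mulmx m n (f : {linear 'cV[k]_n -> 'cV[k]_m}) :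
  exists A : 'M_(m, n), forall v, A *m v = f v.
Proof.
(* [lin1_mx] represents linear maps on row vectors, hence the transpositions. *)
exists (lin1_mx (trmx \o f \o trmx))^T => v.
by rewrite -[v in LHS]trmxK -trmx_mul mul_rV_lin1 /= !trmxK.
Qed.

Lemma mulmx_inj m n (A B : 'M[k]_(m, n)) :
  (forall v : 'cV_n, A *m v = B *m v) -> A = B.
Proof.
move=> AB; apply/trmx_inj/row_matrixP => j.
by rewrite -!tr_col !colE AB.
Qed.

Lemma mcoeff_sumU (X : finType) (c : X -> k) (x : X) :
  (\sum_y c y *: << (y : {classic X}) >>)@_(x : {classic X}) = c x.
Proof.
rewrite raddf_sum (bigD1 x) //= mcoeffZ mcoeffUU mulr1 big1 ?addr0 // => y yx.
rewrite mcoeffZ mcoeffU; case: eqP => [yx'|_]; last by rewrite mulr0.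
by rewrite yx' eqxx in yx.
Qed.

Lemma kmx_surj (X Y : finType) (A : 'M[k]_(#|Y|, #|X|)) :
  exists f : kkl k X Y, kmx f = A.
Proof.
exists (fun x => \sum_y A (enum_rank y) (enum_rank x) *: << (y : {classic Y}) >>).
apply/matrixP => i j; rewrite mxE /fm_coef mcoeff_sumU.
by rewrite !enum_valK.
Qed.

Lemma Phi_surj (X : finType) (A : 'M[k]_#|X|) : exists f : kH k X, Phi f = A.
Proof.
exists (fun _ => \sum_(p : X * X)
  A (enum_rank p.1) (enum_rank p.2) *: << (p : {classic X * X}) >>).
apply/matrixP => i j; rewrite mxE /fm_coef mcoeff_sumU.
by rewrite !enum_valK.
Qed.

End Matrices.

HB.instance Definition _ (k : fieldType) (X : finType) :=
  GRing.isLinear.Build k (kH k X) 'M[k]_#|X| *:%R (@Phi k X) (@Phi_linear k X).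

(** * Representations over the free module monad *)

Section GroupAlgebra.
Variables (k : fieldType) (G : groupType).

Lemma group_algebra_linear_eq (V : lmodType k)
    (L1 L2 : {linear group_algebra k G -> V}) :
  (forall g, L1 (gabas k g) = L2 (gabas k g)) -> L1 =1 L2.
Proof. exact: eq_linear. Qed.

(** The universal property of the group algebra with respect to the convolution
    algebra of X: extend D linearly; multiplicativity is then bilinear in both
    factors, hence can be tested on group elements.  The test is made on
    matrices, where the product is known to be bilinear. *)
Section Extension.
Variables (X : finType) (D : G -> kH k X).
Hypothesis D1 : D 1%g = 1.
Hypothesis DM : {morph D : g h / (g * h)%g >-> g * h}.

Let extend (a : group_algebra k G) : kH k X := linext D a.

Let extend_linear : linear extend.
Proof. exact: linext_is_linear. Qed.

Let PhiE a : Phi (extend a) = linext (fun g => Phi (D g)) a.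
Proof. exact: linear_linext. Qed.

Let extend_monoid_morphism : (extend 1 = 1) * {morph extend : a b / a * b}.
Proof.
split=> [|a b]; first by rewrite -D1 [LHS]linextU.
apply: Phi_inj; rewrite [RHS]PhiM !PhiE.
set M := fun g => Phi (D g).
rewrite [LHS]linear_linext -[RHS]/(mulmxr (linext M b) (linext M a)).
rewrite [RHS]linear_linext; apply: eq_linext => g /=.
rewrite !linear_linext; apply: eq_linext => h /=.
by rewrite linextU /M DM PhiM.
Qed.

Definition group_algebra_extend : {lrmorphism group_algebra k G -> kH k X} :=
  HB.pack_for {lrmorphism group_algebra k G -> kH k X} extend
    (GRing.isLinear.Build k (group_algebra k G) (kH k X) *:%R extend extend_linear)
    (GRing.isMonoidMorphism.Build (group_algebra k G) (kH k X) extend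
      extend_monoid_morphism).

Lemma group_algebra_extendE g : group_algebra_extend (gabas k g) = D g.
Proof. exact: linextU. Qed.

End Extension.

Definition lklcrep_mx (R : lklcrep k G) (g : G) : 'M[k]_#|R| :=
  Phi (lklcrep_hom R (gabas k g)).

Lemma lklcrep_mx1 (R : lklcrep k G) : lklcrep_mx R 1%g = 1%:M.
Proof.
rewrite /lklcrep_mx -[gabas k 1%g]/(1 : group_algebra k G) rmorph1.
exact: Phi1.
Qed.

Lemma lklcrep_mxM (R : lklcrep k G) g h :
  lklcrep_mx R (g * h)%g = lklcrep_mx R g *m lklcrep_mx R h.
Proof.
rewrite /lklcrep_mx -gamulUU.
rewrite -[gamul _ _]/(gabas k g * gabas k h : group_algebra k G) rmorphM.
exact: PhiM.
Qed.

(** Both sides of the intertwining relation are linear in the element of the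
    group algebra, which is a combination of elements of G. *)
Lemma lklcrep_intertwiningP (R S : lklcrep k G) (f : kkl k R S) :
  reflect (forall g, lklcrep_mx S g *m kmx f = kmx f *m lklcrep_mx R g)
    (f \in @lklcrep_intertwining k G R S).
Proof.
apply: (iffP idP) => [/asboolP fP g|fP]; first exact: fP.
apply/asboolP => a.
pose L := mulmxr (kmx f) \o @Phi k S \o lklcrep_hom S.
pose L' := mulmx (kmx f) \o @Phi k R \o lklcrep_hom R.
exact: (@group_algebra_linear_eq _ L L' fP).
Qed.

Definition lklcrep_act (R : lklcrep k G) (g : G) : 'End('cV[k]_#|R|) :=
  linfun (mulmx (lklcrep_mx R g)).

Lemma lklcrep_act_GL (R : lklcrep k G) g : lker (lklcrep_act R g) == 0%VS.
Proof.
apply/lker0P; apply: (can_inj (g := mulmx (lklcrep_mx R g^-1%g))) => v.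
by rewrite lfunE /= mulmxA -lklcrep_mxM mulVg lklcrep_mx1 mul1mx.
Qed.

Lemma lklcrep_actM (R : lklcrep k G) g h :
  lklcrep_act R (g * h)%g = (lklcrep_act R g \o lklcrep_act R h)%VF.
Proof. by apply/lfunP => v; rewrite !lfunE /= !lfunE /= lklcrep_mxM mulmxA. Qed.

Definition lklcrep_lin_rep (R : lklcrep k G) : lin_rep k G :=
  LinRep (lklcrep_act_GL R) (@lklcrep_actM R).

Lemma lklcrep_lin_repE (R : lklcrep k G) g (v : 'cV[k]_#|R|) :
  lin_rep_act (lklcrep_lin_rep R) g v = lklcrep_mx R g *m v.
Proof. exact: lfunE. Qed.

Definition kmx_lfun (R S : lklcrep k G) (f : kkl k R S) :
    'Hom(lklcrep_lin_rep R, lklcrep_lin_rep S) :=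
  linfun (mulmx (kmx f)).

Lemma kmx_lfunE (R S : lklcrep k G) (f : kkl k R S) (v : 'cV[k]_#|R|) :
  kmx_lfun f v = kmx f *m v.
Proof. exact: lfunE. Qed.

Lemma kmx_lfun_equivariant (R S : lklcrep k G) (f : lklcrep_mor R S) :
  kmx_lfun f \in @lin_rep_equivariant k G _ _.
Proof.
have /lklcrep_intertwiningP fP := valP f; apply/asboolP => g v.
by rewrite kmx_lfunE !lklcrep_lin_repE kmx_lfunE !mulmxA fP.
Qed.

Definition lklcrep_mor_lin (R S : lklcrep k G) (f : lklcrep_mor R S) :
    lin_rep_mor (lklcrep_lin_rep R) (lklcrep_lin_rep S) :=
  LinRepMor (kmx_lfun_equivariant f).

Lemma lklcrep_mor_lin_id (R : lklcrep k G) :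
  lklcrep_mor_lin (lklcrep_id R) = lin_rep_id (lklcrep_lin_rep R).
Proof.
apply/val_inj/lfunP => v.
by rewrite [LHS]kmx_lfunE /= kmx_id mul1mx id_lfunE.
Qed.

Lemma lklcrep_mor_lin_comp (R S T : lklcrep k G)
    (h : lklcrep_mor S T) (f : lklcrep_mor R S) :
  lklcrep_mor_lin (lklcrep_comp h f) =
  lin_rep_comp (lklcrep_mor_lin h) (lklcrep_mor_lin f).
Proof.
apply/val_inj/lfunP => v.
by rewrite [LHS]kmx_lfunE [RHS]comp_lfunE !kmx_lfunE /= kmx_comp mulmxA.
Qed.

Definition LKlcrep_to_Rep : functor (LKlcrep k G) (Rep k G) :=
  @Functor (LKlcrep k G) (Rep k G) lklcrep_lin_rep lklcrep_mor_lin
    lklcrep_mor_lin_id lklcrep_mor_lin_comp.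

Lemma LKlcrep_to_Rep_linear : linear_functor LKlcrep_to_Rep.
Proof.
move=> R S c f g; apply/val_inj/lfunP => v.
rewrite [LHS]kmx_lfunE /= add_lfunE scale_lfunE !lfunE /=.
by rewrite kmx_linear mulmxDl -scalemxAl.
Qed.

Lemma LKlcrep_to_Rep_faithful : faithful LKlcrep_to_Rep.
Proof.
move=> R S f g fg; apply/val_inj/kmx_inj/mulmx_inj => v.
rewrite -!kmx_lfunE.
exact: (congr1 (fun h : lin_rep_mor (lklcrep_lin_rep R) (lklcrep_lin_rep S) =>
  h v) fg).
Qed.

Lemma LKlcrep_to_Rep_full : full LKlcrep_to_Rep.
Proof.
move=> R S [h hP].
have [A hA] := linear_mulmx h.
have [f fA] := kmx_surj A.
suff fP : f \in @lklcrep_intertwining k G R S.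
  exists (LKlcrepMor fP); apply/val_inj/lfunP => v.
  by rewrite [LHS]kmx_lfunE /= fA hA.
apply/lklcrep_intertwiningP => g; apply: mulmx_inj => v.
move/asboolP/(_ g v): hP; rewrite !lfunE /= -!hA => hP.
by rewrite fA -!mulmxA hP.
Qed.

(** As for permutations, the action of 1 is idempotent and injective. *)
Lemma lin_rep_act1 (V : lin_rep k G) v : lin_rep_act V 1%g v = v.
Proof.
have /lker0P := lin_rep_GL V 1%g; apply.
by rewrite -comp_lfunE -lin_rep_actM mulg1.
Qed.

(** The equation on n is a hypothesis because n is to be the cardinal of a
    finite type of dim V elements, which equals dim V but does not compute to
    it. *)
Lemma vect_coordinates (V : vectType k) n : n = dim V ->
  exists (e : 'Hom('cV[k]_n, V)) (e' : 'Hom(V, 'cV[k]_n)),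
    cancel e e' /\ cancel e' e.
Proof.
move=> ->; exists (linfun (r2v \o trmx)), (linfun (trmx \o v2r)).
by split=> v; rewrite !lfunE /= ?r2vK ?trmxK ?v2rK.
Qed.

(** Coordinates on V turn the elements of G into matrices, which extend to a
    representation of the group algebra; the coordinates are then an
    equivariant isomorphism between V and the columns on which it acts. *)
Lemma LKlcrep_to_Rep_essentially_surjective :
  essentially_surjective LKlcrep_to_Rep.
Proof.
move=> V; pose X : finType := 'I_(dim V).
have [e [e' [eK e'K]]] := vect_coordinates (card_ord (dim V) : #|X| = dim V).
(* D g is the element of the convolution algebra with the matrix of g in the
   coordinates e. *)
have DV g : {d : kH k X | forall v, Phi d *m v = e' (lin_rep_act V g (e v))}.
  apply: cid.
  have [A AE] := linear_mulmx (e' \o lin_rep_act V g \o e).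
  have [d dA] := Phi_surj A.
  by exists d => v; rewrite dA AE.
pose D g := sval (DV g).
have DE g v : Phi (D g) *m v = e' (lin_rep_act V g (e v)) := svalP (DV g) v.
have D1 : D 1%g = 1.
  apply/Phi_inj/mulmx_inj => v.
  by rewrite DE lin_rep_act1 eK [Phi 1]Phi1 mul1mx.
have DM : {morph D : g h / (g * h)%g >-> g * h}.
  move=> g h; apply/Phi_inj/mulmx_inj => v.
  by rewrite [Phi (_ * _)]PhiM -mulmxA !DE e'K lin_rep_actM comp_lfunE.
pose R := MkLklcrep (group_algebra_extend D1 DM).
have actE g v : lin_rep_act (lklcrep_lin_rep R) g v = e' (lin_rep_act V g (e v)).
  by rewrite lfunE /= /lklcrep_mx group_algebra_extendE DE.
have eP : e \in @lin_rep_equivariant k G (lklcrep_lin_rep R) V.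
  by apply/asboolP => g v; rewrite actE e'K.
have e'P : e' \in @lin_rep_equivariant k G V (lklcrep_lin_rep R).
  by apply/asboolP => g v; rewrite actE e'K.
exists R, (LinRepMor eP), (LinRepMor e'P).
by split; apply/val_inj/lfunP => v; rewrite /= comp_lfunE id_lfunE.
Qed.

End GroupAlgebra.

Theorem theorem1 (G : groupType) (k : fieldType) :
  (is_category (Klcrep G) /\ equivalent (Klcrep G) (Perm G)) /\
  (is_linear_category (LKlcrep k G) /\
   linearly_equivalent (LKlcrep k G) (Rep k G)).
Proof.
split; split.
- exact: Klcrep_is_category.
- exact: Klcrep_equivalent_Perm.
- exact: faithful_is_linear_category (@Rep_is_linear_category k G)
    (@LKlcrep_to_Rep_linear k G) (@LKlcrep_to_Rep_faithful k G).
- exact: fully_faithful_linearly_equivalent (@Rep_is_linear_category k G)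
    (@LKlcrep_to_Rep_linear k G) (@LKlcrep_to_Rep_faithful k G)
    (@LKlcrep_to_Rep_full k G) (@LKlcrep_to_Rep_essentially_surjective k G).
Qed.
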